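(* Let $k\in\omega$, $X\in\mathrm{QCB}_0(\mathbf{\Pi}^1_k)$ and $Y\in\mathrm{QCB}_0(\mathbf{\Sigma}^1_k)$. Then $Y^X\in\mathrm{QCB}_0(\mathbf{\Pi}^1_{k+1})$.
   Context: For $\mathrm{QCB}_0$-spaces ($T_0$ topological quotients of countably based spaces) $X,Y$, $Y^X$ is the $\mathrm{QCB}_0$-exponential: the set of continuous functions $X\to Y$ with the sequentialization of the compact-open topology. Let $\mathcal{N}=\omega^\omega$ be the Baire space. For a space $Z$: $\mathbf{\Pi}^0_2(Z)$ = complements of countable unions of sets $U\setminus V$ with $U,V$ open; $\mathbf{\Sigma}^1_1(Z)=\{pr_Z(A)\mid A\in\mathbf{\Pi}^0_2(\mathcal{N}\times Z)\}$, $\mathbf{\Sigma}^1_{n+1}(Z)=\{pr_Z(A)\mid A\in\mathbf{\Pi}^1_n(\mathcal{N}\times Z)\}$ with $pr_Z(A)=\{z\mid\exists p\in\mathcal{N}\,(p,z)\in A\}$; $\mathbf{\Pi}^1_n(Z)$ = complements of $\mathbf{\Sigma}^1_n(Z)$-sets; $\mathbf{\Delta}^1_n=\mathbf{\Sigma}^1_n\cap\mathbf{\Pi}^1_n$; by convention $\mathbf{\Sigma}^1_0=\mathbf{\Pi}^1_0=\mathbf{\Delta}^1_1$. A representation of $X$ is a surjection $\delta$ from $\mathrm{dom}(\delta)\subseteq\mathcal{N}$ onto $X$; it is admissible if continuous and every continuous $\nu:W\to X$ from a zero-dimensional countably based $T_0$-space $W$ factors as $\nu=\delta g$ with $g:W\to\mathrm{dom}(\delta)$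 continuous. $\mathit{EQ}(\delta)=\{(p,q)\mid p,q\in\mathrm{dom}(\delta),\delta(p)=\delta(q)\}$. $\mathrm{QCB}_0(\Gamma)$ is the class of spaces having an admissible representation $\delta$ with $\mathit{EQ}(\delta)\in\Gamma(\mathcal{N}\times\mathcal{N})$. *)

(* Defs.v *)
From HB Require Import structures.
From mathcomp Require Import all_boot all_classical topology.

Local Open Scope classical_set_scope.

Definition baire : Type := prod_topology (fun _ : nat => nat).

HB.instance Definition _ := Topological.on baire.

Definition pointclass := forall Z : topologicalType, set (set Z).

Definition co (G : pointclass) : pointclass :=
  fun Z => [set ~` A | A in G Z].

Definition ambiguous (G : pointclass) : pointclass :=
  fun Z => G Z `&` co G Z.

Definition pr {Z : Type} (A : set (baire * Z)) : set Z :=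
  [set z | exists p : baire, A (p, z)].

(* On non-metrizable spaces open sets need not be F_sigma, hence the use of
   differences of open sets. *)
Definition Sigma02 : pointclass := fun Z =>
  [set A | exists U V : nat -> set Z,
    [/\ forall n, open (U n), forall n, open (V n) &
        A = \bigcup_n (U n `\` V n)]].

Definition Pi02 : pointclass := co Sigma02.

(* [projective n] is $\Sigma^1_{n+1}$; the space varies along the recursion. *)
Fixpoint projective (n : nat) (Z : topologicalType) : set (set Z) :=
  match n with
  | 0 => [set pr A | A in Pi02 (baire * Z)%type]
  | m.+1 => [set pr A | A in co (projective m) (baire * Z)%type]
  end.

Definition Delta11 : pointclass := ambiguous (projective 0).

(* Convention: $\Sigma^1_0 = \Pi^1_0 = \Delta^1_1$. *)
Definition Sigma1 (k : nat) : pointclass :=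
  if k is n.+1 then projective n else Delta11.

Definition Pi1 (k : nat) : pointclass :=
  if k is n.+1 then co (projective n) else Delta11.

Definition quotient_map {A X : topologicalType} (f : A -> X) : Prop :=
  (forall x, exists a, f a = x) /\
  (forall U : set X, open U <-> open (f @^-1` U)).

Definition qcb0 (X : topologicalType) : Prop :=
  kolmogorov_space X /\
  exists2 A : topologicalType, @second_countable A &
    exists f : A -> X, quotient_map f.

(* The library's [zero_dimensional] only asks that distinct points be separated
   by a clopen set; here the clopen sets have to form a basis. *)
Definition clopen_basis (W : topologicalType) : Prop := basis (@clopen W).

(* A partial map from [baire] to [X] with domain [D] is a function on the
   subspace [set_type D]; in particular [X] may be empty. *)
Definition representation {X : Type} {D : set baire} (delta : D -> X) : Prop :=
  forall x, exists p, delta p = x.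

Definition admissible {X : topologicalType} {D : set baire}
    (delta : D -> X) : Prop :=
  [/\ representation delta, continuous delta &
      forall W : topologicalType,
        clopen_basis W -> @second_countable W -> kolmogorov_space W ->
        forall nu : W -> X, continuous nu ->
        exists2 g : W -> D, continuous g & forall w, nu w = delta (g w)].

Definition EQ {X : Type} {D : set baire} (delta : D -> X) :
    set (baire * baire) :=
  [set pq | exists p q : D, pq = (val p, val q) /\ delta p = delta q].

Definition QCB0 (G : pointclass) (X : topologicalType) : Prop :=
  qcb0 X /\
  exists (D : set baire) (delta : D -> X),
    admissible delta /\ G (baire * baire)%type (EQ delta).

Definition seq_open {T : topologicalType} (A : set T) : Prop :=
  forall (u : nat -> T) (x : T),
    A x -> u n @[n --> \oo] --> x -> \forall n \near \oo, A (u n).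

Definition sequentialization (T : Type) : Type := T.

Section sequentialization.
Context (T : topologicalType).

Local Lemma seq_openT : @seq_open T setT.
Proof. by move=> u x _ _; exact: nearW. Qed.

Local Lemma seq_openI : setI_closed (@seq_open T).
Proof.
by move=> A B oA oB u x [Ax Bx] ux; apply: filterI; [exact: oA ux|exact: oB ux].
Qed.

Local Lemma seq_open_bigU (I : Type) (f : I -> set T) :
  (forall i, seq_open (f i)) -> seq_open (\bigcup_i f i).
Proof.
move=> of_ u x [i _ fix_] ux.
by have := of_ i u x fix_ ux; apply: filterS => n ?; exists i.
Qed.

HB.instance Definition _ := Choice.copy (sequentialization T) T.
HB.instance Definition _ :=
  isOpenTopological.Build (sequentialization T) seq_openT seq_openI seq_open_bigU.

End sequentialization.

(* The inner topology is the compact-open topology restricted to the continuous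
   functions. *)
Definition exponential (X Y : topologicalType) : topologicalType :=
  sequentialization
    (initial_topology (id : continuousType X Y -> {compact-open, X -> Y})).

(* Main.v *)
Require Import Defs.
From mathcomp Require Import all_boot all_classical topology.

(** A name [p] of a continuous map [f : X -> Y] codes a partial continuous map
    of the Baire space that carries every [delta]-name of [x] to a
    [gamma]-name of [f x].  Two sequences [p], [q] name the same [f] iff
    [(p a, q b)] is defined and lies in [EQ gamma] for all [(a, b)] in
    [EQ delta]; negating this yields a projection of a set built from
    [EQ delta], the complement of [EQ gamma] and sets of low Borel class.
    For admissibility, a continuous [nu : W -> Y^X] uncurries to a map
    [W * dom delta -> Y], continuous because the domain is sequential; it lifts
    through [gamma], and the lift is curried into names.  Since admissible
    representations lift convergent sequences, they are quotient maps onto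
    sequential spaces, so the names also witness that [Y^X] is a
    [QCB0]-space. *)

Local Open Scope classical_set_scope.

(** * Subspaces of the Baire space *)

Lemma eq_in_mkseq (f g : nat -> nat) m :
  mkseq f m = mkseq g m <-> forall i, i < m -> f i = g i.
Proof.
split=> [e i im|fg]; first by rewrite -(nth_mkseq 0 f im) e nth_mkseq.
by apply: (@eq_from_nth _ 0); rewrite !size_mkseq// => i im; rewrite !nth_mkseq ?fg.
Qed.

Lemma eq_mkseq_le (f g : nat -> nat) m n : m <= n ->
  mkseq f n = mkseq g n -> mkseq f m = mkseq g m.
Proof.
move=> mn /eq_in_mkseq fg; apply/eq_in_mkseq => i im.
by apply: fg; exact: leq_trans mn.
Qed.

Lemma nbhs_nat (n : nat) (A : set nat) : nbhs n A <-> A n.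
Proof.
by split=> [/nbhs_singleton //|An]; rewrite nbhs_principalE; exact/principal_filterP.
Qed.

Lemma near_mkseq_id (p : baire) m :
  \forall q \near p, mkseq (q : nat -> nat) m = mkseq p m.
Proof.
elim: m => [|m IH]; first exact: (@filterS _ _ _ setT _ _ filterT).
have H : \forall q \near p, q m = p m.
  by have := @proj_continuous nat (fun _ => nat) m p [set p m]; apply; apply/nbhs_nat.
by apply: filterS2 IH H => q; rewrite !mkseqS => -> ->.
Qed.

Lemma baire_nbhs (p : baire) (A : set baire) :
  nbhs p A <-> exists m, forall q : baire, mkseq q m = mkseq p m -> A q.
Proof.
split; last first.
  by move=> [m mA]; apply: filterS (near_mkseq_id p m).
pose F := filter_from setT (fun m => [set q : baire | mkseq q m = mkseq p m]).
have FF : Filter F.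
  apply: filter_from_filter; first by exists 0.
  move=> i j _ _; exists (maxn i j) => // q /= qp.
  by split; apply: eq_mkseq_le qp; rewrite ?leq_maxl ?leq_maxr.
suff: F --> p by move=> /[apply] -[m _]; exists m.
(* The product topology is the supremum of the topologies induced by the coordinates; fixing [i.+1]
   entries fixes coordinate [i]. *)
apply/cvg_sup => i U [_ [[V oV <-] Vp] /filterS]; apply.
exists i.+1 => // q /= /eq_in_mkseq/(_ i (ltnSn i)) e.
by have : V (p i) := Vp; rewrite -e.
Qed.

(* [e] induces the topology of [W]; injectivity is required only in [coded]. *)
Definition coding {W : topologicalType} (e : W -> baire) :=
  forall w A, nbhs w A <->
    exists m, forall w', mkseq (e w') m = mkseq (e w) m -> A w'.

Definition coded (W : topologicalType) :=
  exists e : W -> baire, coding e /\ injective e.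

Lemma baire_coded : coded baire.
Proof. by exists id; split => // p A; exact: baire_nbhs. Qed.

Lemma val_continuous (D : set baire) : continuous (val : D -> baire).
Proof. exact: (@initial_continuous D baire val). Qed.

Lemma subset_coding (D : set baire) : coding (val : D -> baire).
Proof.
move=> p A; split.
  move=> [_ [[V oV <-] Vp] VA].
  have /baire_nbhs[m mV] : nbhs (val p) V by exact: open_nbhs_nbhs.
  by exists m => q /mV Vq; apply: VA.
move=> [m mA].
have H : \forall q \near p, mkseq (val q : baire) m = mkseq (val p : baire) m.
  by have := @val_continuous D p _ (near_mkseq_id (val p) m).
by apply: filterS H => q; exact: mA.
Qed.

Lemma subset_coded (D : set baire) : coded D.
Proof. by exists val; split; [exact: subset_coding | exact: val_inj]. Qed.

Lemma prod_coded (V W : topologicalType) : coded V -> coded W ->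
  coded (V * W)%type.
Proof.
move=> [e [ce ie]] [f [cf jf]].
(* Pairing entry by entry lets a prefix of the joint code carry prefixes of the same length of both
   codes. *)
pose g (z : V * W) : baire := fun n => pickle (e z.1 n, f z.2 n).
have gE z z' m : mkseq (g z) m = mkseq (g z') m <->
    mkseq (e z.1) m = mkseq (e z'.1) m /\ mkseq (f z.2) m = mkseq (f z'.2) m.
  split=> [/eq_in_mkseq gz|[/eq_in_mkseq ez /eq_in_mkseq fz]].
    by split; apply/eq_in_mkseq => i /gz /(pcan_inj (@pickleK _))[].
  by apply/eq_in_mkseq => i im; rewrite /g ez ?fz.
exists g; split; last first.
  move=> [v w] [v' w'] gz; congr pair.
    by apply/ie/funext => n; have /(pcan_inj (@pickleK _))[] := congr1 (@^~ n) gz.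
  by apply/jf/funext => n; have /(pcan_inj (@pickleK _))[] := congr1 (@^~ n) gz.
move=> [v w] A; split.
  move=> [[P Q] /= [/ce[i iP] /cf[j jQ]] PQA].
  exists (maxn i j) => -[v' w'] /gE[/= ev fw]; apply: PQA; split => /=.
    by apply: iP; apply: eq_mkseq_le ev; rewrite leq_maxl.
  by apply: jQ; apply: eq_mkseq_le fw; rewrite leq_maxr.
move=> [m mA]; exists ([set v' | mkseq (e v') m = mkseq (e v) m],
  [set w' | mkseq (f w') m = mkseq (f w) m]) => /=.
  by split; [apply/ce|apply/cf]; exists m.
by move=> [v' w'] [/= ev fw]; apply/mA/gE.
Qed.

Lemma coding_near {W : topologicalType} {e : W -> baire} : coding e ->
  forall w m, \forall w' \near w, mkseq (e w') m = mkseq (e w) m.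
Proof. by move=> ce w m; apply/ce; exists m. Qed.

Lemma coding_clopen {W : topologicalType} {e : W -> baire} : coding e ->
  forall m s, clopen [set w | mkseq (e w) m = s].
Proof.
move=> ce m s; split.
  rewrite openE => w /= ws; apply: filterS (coding_near ce w m) => w' /= ->.
  exact: ws.
rewrite -[X in closed X]setCK; apply: open_closedC; rewrite openE => w /= ws.
by apply: filterS (coding_near ce w m) => w' /= ->.
Qed.

Lemma second_countableP {T : topologicalType} : @second_countable T <->
  exists b : nat -> set T, (forall i, open (b i)) /\
    forall x A, nbhs x A -> exists i, b i x /\ b i `<=` A.
Proof.
split.
  move=> [B /countable_injP[f finj] [Bo Bn]].
  (* An index outside the range of [f] on [B] gets the default [setT], which is open. *)
  pose b i := xget setT [set U | B U /\ f U = i].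
  exists b; split=> [i|x A /Bn[U [BU Ux] UA]].
    by rewrite /b; case: xgetP => [U -> [/Bo]|_] //; exact: openT.
  exists (f U); suff -> : b (f U) = U by [].
  rewrite /b; case: xgetP => [V _ [BV]|/(_ U)[]//].
  by apply: finj; rewrite inE.
move=> [b [bo bn]]; exists (range b); first exact: card_image_le.
split=> [_ [i _ <-] //|x A /bn[i [bx bA]]].
by exists (b i) => //; split => //; exists i.
Qed.

Lemma coding_second_countable {W : topologicalType} {e : W -> baire} :
  coding e -> @second_countable W.
Proof.
move=> ce; apply/second_countableP.
exists (fun i => if unpickle i is Some (m, s)
  then [set w | mkseq (e w) m = s] else set0); split=> [i|w A /ce[m mA]].
  case: unpickle => [[m s]|]; last exact: open0.
  by have [] := coding_clopen ce m s.
by exists (pickle (m, mkseq (e w) m)); rewrite pickleK.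
Qed.

Lemma coding_clopen_basis {W : topologicalType} {e : W -> baire} :
  coding e -> clopen_basis W.
Proof.
move=> ce; split=> [A [] //|w A /ce[m mA]].
exists [set w' | mkseq (e w') m = mkseq (e w) m] => //.
by split=> //; exact: coding_clopen.
Qed.

Lemma coded_kolmogorov {W : topologicalType} : coded W -> kolmogorov_space W.
Proof.
move=> [e [ce ie]] x y xy.
have [n exy] : exists n, e x n <> e y n.
  apply: contrapT => /forallNP h; move/eqP: xy; apply; apply/ie/funext => n.
  exact: contrapT.
exists [set w | mkseq (e w) n.+1 = mkseq (e x) n.+1]; left; rewrite !inE; split.
  exact: coding_near.
by move=> /= /eq_in_mkseq/(_ n (ltnSn n)) /esym.
Qed.

(** The coded spaces are the test spaces in the definition of admissibility. In the harder direction
    a point is coded by its characteristic sequence in a countable clopen base, and the $T_0$ axiom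
    makes this code injective. *)
Lemma codedP (W : topologicalType) : coded W <->
  [/\ clopen_basis W, @second_countable W & kolmogorov_space W].
Proof.
split.
  move=> cW; split; last exact: coded_kolmogorov.
  - by have [e [ce _]] := cW; exact: coding_clopen_basis ce.
  - by have [e [ce _]] := cW; exact: coding_second_countable ce.
move=> [[_ cb] /second_countableP[b [bo bn]] kol].
(* The clopen sets interpolated between two members of the countable base form a
   countable clopen base. *)
pose c (n : nat) : set W := if unpickle n is Some (i, j)
  then xget setT [set C | [/\ clopen C, b i `<=` C & C `<=` b j]] else setT.
have cc n : clopen (c n).
  rewrite /c; case: unpickle => [[i j]|]; last exact: clopenT.
  by case: xgetP => [C -> []|_] //; exact: clopenT.
have cn w A : nbhs w A -> exists n, c n w /\ c n `<=` A.
  move=> /bn[j [bjw bjA]].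
  have /cb[C [cC Cw] Cbj] : nbhs w (b j) by apply: open_nbhs_nbhs; split.
  have /bn[i [biw biC]] : nbhs w C by apply: open_nbhs_nbhs; split => //; case: cC.
  exists (pickle (i, j)); rewrite /c pickleK.
  case: xgetP => [C' _ [_ biC' C'bj]|/(_ C)[]//].
  by split; [exact: biC'|exact: subset_trans bjA].
pose e w : baire := fun n => nat_of_bool `[< c n w >].
have en w n : \forall w' \near w, e w' n = e w n.
  have [co ccl] := cc n; have [cw|ncw] := pselect (c n w).
    apply: filterS (open_nbhs_nbhs (conj co cw)) => w' cw'.
    by rewrite /e !asboolT.
  have := open_nbhs_nbhs (conj (closed_openC ccl) ncw).
  by apply: filterS => w' ncw'; rewrite /e !asboolF.
have eE n w w' : e w' n = e w n -> c n w -> c n w'.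
  by rewrite /e => + cw; rewrite (asboolT cw); case: asboolP.
exists e; split.
  move=> w A; split=> [/cn[n [cw cA]]|[m mA]].
    by exists n.+1 => w' /eq_in_mkseq/(_ n (ltnSn n)) ew; apply/cA/eE; eassumption.
  apply: (@filterS _ _ _ [set w' | mkseq (e w') m = mkseq (e w) m]) => //.
  elim: m {mA} => [|m IH]; first exact: (@filterS _ _ _ setT _ _ filterT).
  by apply: filterS2 IH (en w m) => w' /=; rewrite !mkseqS => -> ->.
move=> x y exy; apply: contrapT => /eqP /kol[A []].
all: rewrite !inE => -[/cn[n [cx cA]] nAy]; apply/nAy/cA/eE; last exact: cx.
all: by rewrite exy.
Qed.

(** * Closure properties of the projective classes *)

Lemma coE (G : pointclass) (Z : topologicalType) (A : set Z) :
  co G Z A <-> G Z (~` A).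
Proof.
by split=> [[B GB <-]|GA]; [rewrite setCK|exists (~` A); rewrite ?setCK].
Qed.

Lemma pair_continuous {Z S T : topologicalType} (f : Z -> S) (g : Z -> T) :
  continuous f -> continuous g -> continuous (fun z => (f z, g z)).
Proof. by move=> cf cg z; apply: cvg_pair; [exact: cf|exact: cg]. Qed.

Lemma fst_continuous {S T : topologicalType} : continuous (@fst S T).
Proof. by move=> z; exact: cvg_fst. Qed.

Lemma snd_continuous {S T : topologicalType} : continuous (@snd S T).
Proof. by move=> z; exact: cvg_snd. Qed.

Lemma comp_continuous {R S T : topologicalType} {f : R -> S} {g : S -> T} :
  continuous f -> continuous g -> continuous (fun x => g (f x)).
Proof. by move=> cf cg x; apply: (continuous_comp (cf x)); exact: cg. Qed.

Lemma continuous_baire {Z : topologicalType} (f : Z -> baire) :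
  (forall n, continuous (fun z => f z n)) -> continuous f.
Proof.
move=> cf z A /baire_nbhs[m mA].
suff : \forall z' \near z, mkseq (f z') m = mkseq (f z) m.
  by apply: filterS => z' /mA.
elim: m {mA} => [|m IH]; first exact: (@filterS _ _ _ setT _ _ filterT).
have H : \forall z' \near z, f z' m = f z m.
  by have := cf m z [set f z m]; apply; exact/nbhs_nat.
by apply: filterS2 IH H => q /=; rewrite !mkseqS => -> ->.
Qed.

Lemma coord_continuous n : continuous (fun p : baire => p n).
Proof. exact: (@proj_continuous nat (fun _ => nat) n). Qed.

(** A point of the Baire space is read as a countable family of points, so that one quantifier can
    supply several witnesses. *)
Definition part (i : nat) (r : baire) : baire := fun n => r (pickle (i, n)).

Definition join (s : nat -> baire) : baire :=
  fun k => if unpickle k is Some (i, n) then s i n else 0.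

Lemma part_join s i : part i (join s) = s i.
Proof. by apply/funext => n; rewrite /part /join pickleK. Qed.

Lemma part_continuous i : continuous (part i).
Proof. by apply: continuous_baire => n; exact: coord_continuous. Qed.

Section Pi02.
Context {Z : topologicalType}.
Implicit Types A B : set Z.

Lemma Pi02_bigcap (O : nat -> set Z) : (forall n, open (O n)) ->
  Pi02 Z (\bigcap_n O n).
Proof.
move=> oO; apply/coE; exists (fun=> setT), O; split => // [n|]; first exact: openT.
by rewrite setC_bigcap; apply: eq_bigcupr => n _; rewrite setTD.
Qed.

Lemma Pi02_open A : open A -> Pi02 Z A.
Proof.
by move=> oA; have := Pi02_bigcap (fun=> A) (fun=> oA); rewrite bigcap_const//; exists 0.
Qed.

Lemma Sigma02_bigcup (F : nat -> set Z) : (forall n, closed (F n)) ->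
  Sigma02 Z (\bigcup_n F n).
Proof.
move=> cF; exists (fun=> setT), (fun n => ~` F n).
split => [n|n|]; [exact: openT|exact: closed_openC|].
by apply: eq_bigcupr => n _; rewrite setTD setCK.
Qed.

Lemma Pi02_closed A : closed A -> Pi02 Z A.
Proof.
move=> cA; apply/coE; exists (fun=> ~` A), (fun=> set0).
split => [n|n|]; [exact: closed_openC|exact: open0|].
by rewrite setD0 bigcup_const//; exists 0.
Qed.

Lemma Pi02I A B : Pi02 Z A -> Pi02 Z B -> Pi02 Z (A `&` B).
Proof.
move=> /coE[U [V [oU oV AE]]] /coE[U' [V' [oU' oV' BE]]]; apply/coE.
(* The two unions are interleaved: odd indices serve [A], even ones [B]. *)
exists (fun n => if odd n then U n./2 else U' n./2).
exists (fun n => if odd n then V n./2 else V' n./2).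
split=> [n|n|]; [by case: odd|by case: odd|].
rewrite setCI AE BE; apply/seteqP; split=> z.
  move=> [|] [n _ nz]; first by exists n.*2.+1; rewrite //= odd_double uphalf_double.
  by exists n.*2; rewrite //= odd_double doubleK.
by move=> [n _]; case: odd => nz; [left|right]; exists n./2.
Qed.

Lemma Pi02U A B : Pi02 Z A -> Pi02 Z B -> Pi02 Z (A `|` B).
Proof.
move=> /coE[U [V [oU oV AE]]] /coE[U' [V' [oU' oV' BE]]]; apply/coE.
(* $(U\setminus V)\cap(U'\setminus V')=(U\cap U')\setminus(V\cup V')$; indices that code no pair
   contribute the empty set. *)
exists (fun k => if unpickle k is Some (i, j) then U i `&` U' j else set0).
exists (fun k => if unpickle k is Some (i, j) then V i `|` V' j else set0).
split=> [n|n|].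
- by case: unpickle => [[i j]|]; [exact: openI|exact: open0].
- by case: unpickle => [[i j]|]; [exact: openU|exact: open0].
rewrite setCU AE BE; apply/seteqP; split=> z.
  move=> [[i _ [Ui Vi]] [j _ [Uj Vj]]]; exists (pickle (i, j)) => //=.
  by rewrite pickleK; split => // -[].
move=> [k _]; case: unpickle => [[i j] [[Ui Uj] nV]|[]//].
by split; [exists i => //; split => // ?; apply: nV; left
          |exists j => //; split => // ?; apply: nV; right].
Qed.

End Pi02.

Lemma Pi02_preimage {Z S : topologicalType} (f : Z -> S) (A : set S) :
  continuous f -> Pi02 S A -> Pi02 Z (f @^-1` A).
Proof.
move=> /continuousP cf /coE[U [V [oU oV AE]]]; apply/coE.
exists (fun n => f @^-1` U n), (fun n => f @^-1` V n).
by split=> [n|n|]; [exact: cf|exact: cf|rewrite preimage_setC AE preimage_bigcup].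
Qed.

Lemma lift_continuous {Z S : topologicalType} (f : Z -> S) : continuous f ->
  continuous (fun pz : baire * Z => (pz.1, f pz.2)).
Proof.
move=> cf; apply: pair_continuous; first exact: fst_continuous.
exact: comp_continuous snd_continuous cf.
Qed.

Lemma part_lift_continuous {Z : topologicalType} i :
  continuous (fun pz : baire * Z => (part i pz.1, pz.2)).
Proof.
apply: pair_continuous; last exact: snd_continuous.
exact: comp_continuous fst_continuous (part_continuous i).
Qed.

Definition closed_preimage (G : pointclass) := forall (Z S : topologicalType)
  (f : Z -> S) (A : set S), continuous f -> G S A -> G Z (f @^-1` A).
Definition closed_setI (G : pointclass) := forall (Z : topologicalType)
  (A B : set Z), G Z A -> G Z B -> G Z (A `&` B).
Definition closed_setU (G : pointclass) := forall (Z : topologicalType)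
  (A B : set Z), G Z A -> G Z B -> G Z (A `|` B).

(** Each level of [projective] is this operator applied to [Pi02] or to [co] of the previous level,
    so its closure properties are proved once for general [G]. *)
Definition proj_class (G : pointclass) : pointclass :=
  fun Z => [set pr A | A in G (baire * Z)%type].

Lemma proj_class_preimage G : closed_preimage G -> closed_preimage (proj_class G).
Proof.
move=> Gf Z S f _ cf [A GA <-].
by exists ((fun pz => (pz.1, f pz.2)) @^-1` A) => //; apply: Gf => //; exact: lift_continuous.
Qed.

Lemma proj_class_setU G : closed_setU G -> closed_setU (proj_class G).
Proof.
move=> GU Z _ _ [A GA <-] [B GB <-]; exists (A `|` B); first exact: GU.
apply/seteqP; split=> z; first by move=> [p [|]]; [left|right]; exists p.
by move=> [|] [p]; exists p; [left|right].
Qed.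

Lemma proj_class_setI G : closed_preimage G -> closed_setI G ->
  closed_setI (proj_class G).
Proof.
move=> Gf GI Z _ _ [A GA <-] [B GB <-].
exists ([set pz | A (part 0 pz.1, pz.2)] `&` [set pz | B (part 1 pz.1, pz.2)]).
  by apply: GI; apply: Gf => //; exact: part_lift_continuous.
apply/seteqP; split=> z; first by move=> [p [Ap Bp]]; split; eexists; eassumption.
move=> [[p Ap] [q Bq]]; exists (join (fun i => if i == 0 then p else q)).
by split; rewrite /= part_join.
Qed.

(** Two successive quantifiers over the Baire space merge into one through [part 0] and [part 1]. *)
Lemma proj_class_pr G : closed_preimage G -> forall (Z : topologicalType) (A : set (baire * Z)),
  proj_class G (baire * Z)%type A -> proj_class G Z (pr A).
Proof.
move=> Gf Z _ [A GA <-].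
exists [set pz | A (part 0 pz.1, (part 1 pz.1, pz.2))].
  apply: (Gf _ _ (fun pz => (part 0 pz.1, (part 1 pz.1, pz.2)))) => //.
  apply: pair_continuous; last exact: part_lift_continuous.
  exact: comp_continuous fst_continuous (part_continuous 0).
apply/seteqP; split=> z.
  by move=> [p Ap]; exists (part 1 p), (part 0 p).
move=> [p [q Apq]]; exists (join (fun i => if i == 0 then q else p)).
by rewrite /= !part_join.
Qed.

Lemma proj_class_snd G : closed_preimage G -> forall (Z : topologicalType) (A : set Z),
  G Z A -> proj_class G Z A.
Proof.
move=> Gf Z A GA; exists (snd @^-1` A); first exact: Gf snd_continuous GA.
by apply/seteqP; split=> z; [move=> []|exists (fun=> 0)].
Qed.

Lemma co_preimage G : closed_preimage G -> closed_preimage (co G).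
Proof. by move=> Gf Z S f A cf /coE GA; apply/coE; exact: (Gf Z S f (~` A)). Qed.

Lemma co_setI G : closed_setU G -> closed_setI (co G).
Proof. by move=> GU Z A B /coE ? /coE ?; apply/coE; rewrite setCI; exact: GU. Qed.

Lemma co_setU G : closed_setI G -> closed_setU (co G).
Proof. by move=> GI Z A B /coE ? /coE ?; apply/coE; rewrite setCU; exact: GI. Qed.

Lemma projective_preimage n : closed_preimage (projective n).
Proof.
elim: n => [|n IH].
  by apply: proj_class_preimage => Z S f A; exact: Pi02_preimage.
exact/proj_class_preimage/co_preimage.
Qed.

Lemma projective_setIU n : closed_setI (projective n) /\ closed_setU (projective n).
Proof.
elim: n => [|n [IHI IHU]]; split.
- apply: proj_class_setI; first by move=> Z S f A; exact: Pi02_preimage.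
  by move=> Z A B; exact: Pi02I.
- by apply: proj_class_setU => Z A B; exact: Pi02U.
- apply: proj_class_setI; last exact: co_setI.
  exact/co_preimage/projective_preimage.
- exact/proj_class_setU/co_setU.
Qed.

Lemma projective_pr n (Z : topologicalType) (A : set (baire * Z)) :
  projective n (baire * Z)%type A -> projective n Z (pr A).
Proof.
case: n => [|n]; apply: proj_class_pr; first by move=> ? ? ? ?; exact: Pi02_preimage.
exact/co_preimage/projective_preimage.
Qed.

(** The projection absorbs the countable union: the index is read off as the entry [p 0] of the
    witness. As this entry is locally constant, what remains is an open set intersected with a
    closed one. *)
Lemma Sigma02_projective0 (Z : topologicalType) (A : set Z) :
  Sigma02 Z A -> projective 0 Z A.
Proof.
move=> [U [V [oU oV ->]]].
have oW (W : nat -> set Z) : (forall n, open (W n)) ->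
    open [set pz : baire * Z | W (pz.1 0) pz.2].
  move=> oW; rewrite openE => -[p z] /= Wz.
  exists ([set q | q 0 = p 0], W (p 0)) => /=; last by move=> [q z'] [/= ->].
  split; last exact: open_nbhs_nbhs.
  by have := coord_continuous 0 p [set p 0]; apply; exact/nbhs_nat.
exists ([set pz | U (pz.1 0) pz.2] `&` ~` [set pz | V (pz.1 0) pz.2]).
  by apply: Pi02I; [exact/Pi02_open/oW|exact/Pi02_closed/open_closedC/oW].
apply/seteqP; split=> z; first by move=> [p pz]; exists (p 0).
by move=> [n _ nz]; exists (fun=> n).
Qed.

(** The two Borel classes are treated together because complementation, used at every level of the
    induction, exchanges them. *)
Lemma projective_Pi02_Sigma02 n (Z : topologicalType) :
  Pi02 Z `|` Sigma02 Z `<=` projective n Z `&` co (projective n) Z.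
Proof.
have C (A : set Z) : (Pi02 Z `|` Sigma02 Z) A -> (Pi02 Z `|` Sigma02 Z) (~` A).
  by move=> [/coE|SA]; [right|left; apply/coE; rewrite setCK].
suff H : Pi02 Z `|` Sigma02 Z `<=` projective n Z.
  by move=> A PA; split; [exact: H|exact/coE/H/C].
elim: n => [|n IH] A.
  move=> [PA|]; last exact: Sigma02_projective0.
  by apply: proj_class_snd PA => ? ? ? ?; exact: Pi02_preimage.
move=> /C/IH/coE; apply: proj_class_snd.
exact/co_preimage/projective_preimage.
Qed.

(** * Sequences, liftings and quotient maps *)

(** If [x] were not interior to [A], one could choose for every [n] a point outside [A] lying in
    those of the first [n] base sets that contain [x]; these points converge to [x]. *)
Lemma second_countable_sequential {T : topologicalType} : @second_countable T ->
  forall A : set T, seq_open A -> open A.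
Proof.
move=> /second_countableP[b [bo bn]] A sA; rewrite openE => x Ax.
apply: contrapT => nA.
have h n : exists y, (forall i, i < n -> b i x -> b i y) /\ ~ A y.
  apply: contrapT => /forallNP hn; apply: nA.
  have : \forall y \near x, forall i, i < n -> b i x -> b i y.
    elim: n {hn} => [|n IH]; first exact: (@filterS _ _ _ setT _ _ filterT).
    have H : \forall y \near x, b n x -> b n y.
      have [bx|nbx] := pselect (b n x); last exact: (@filterS _ _ _ setT _ _ filterT).
      by apply: filterS (open_nbhs_nbhs (conj (bo n) bx)).
    apply: filterS2 IH H => y IH H i; rewrite ltnS leq_eqVlt => /orP[/eqP -> //|].
    exact: IH.
  by apply: filterS => y hy; apply: contrapT => nAy; apply: (hn y).
have [u hu] := choice h.
have ux : u n @[n --> \oo] --> x.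
  move=> B /bn[i [bx bB]]; exists i.+1 => // n /= ni; apply: bB.
  by have [+ _] := hu n; apply.
by have [N _ /(_ N (leqnn N))] := sA _ _ Ax ux; have [_] := hu N.
Qed.

Lemma seq_continuous {W T : topologicalType} (f : W -> T) : @second_countable W ->
  (forall (u : nat -> W) w, u n @[n --> \oo] --> w -> f (u n) @[n --> \oo] --> f w) ->
  continuous f.
Proof.
move=> cW fs; apply/continuousP => A oA; apply: second_countable_sequential => //.
by move=> u w Aw /fs; apply; exact: open_nbhs_nbhs.
Qed.

Lemma qcb0_sequential {X : topologicalType} : qcb0 X ->
  forall A : set X, seq_open A -> open A.
Proof.
move=> [_ [A cA [f [_ fq]]]] U sU; apply/fq.
have cf : continuous f by apply/continuousP => V /fq.
apply: second_countable_sequential => // u x Ux ux.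
by apply: (sU (f \o u) (f x)) => //; apply: continuous_cvg => //; exact: cf.
Qed.

Definition lifting {X : topologicalType} {D : set baire} (delta : D -> X) :=
  forall W : topologicalType, coded W -> forall nu : W -> X, continuous nu ->
    exists2 g : W -> D, continuous g & forall w, nu w = delta (g w).

Lemma admissibleP {X : topologicalType} {D : set baire} (delta : D -> X) :
  admissible delta <-> continuous delta /\ lifting delta.
Proof.
split=> [[_ cd l]|[cd l]]; first by split => // W /codedP[]; exact: l.
split => // [x|W cb sc kol]; last by apply: l; apply/codedP.
(* Surjectivity comes from lifting a constant map. *)
have [g _ /(_ (fun=> 0)) e] := l _ baire_coded _ (@cst_continuous baire X x).
by exists (g (fun=> 0)).
Qed.

Lemma lifting_cvg {X : topologicalType} {D : set baire} (delta : D -> X) :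
  lifting delta -> forall (u : nat -> X) x, u n @[n --> \oo] --> x ->
  exists (a : nat -> D) a0,
    [/\ a n @[n --> \oo] --> a0, forall n, delta (a n) = u n & delta a0 = x].
Proof.
move=> l u x ux.
(* [nu] sends the indicator of [n] to [u n] and the zero sequence to [x]. *)
pose first (p : baire) i := p i <> 0 /\ forall j, j < i -> p j = 0.
pose nu (p : baire) := xget x [set y | exists2 i, first p i & y = u i].
have nuE p i : first p i -> nu p = u i.
  move=> [pi pj]; rewrite /nu; case: xgetP => [_ _ [k [pk pk'] ->]|/(_ (u i))[]]; last by exists i.
  by have [/pk'|/pj|->] := ltngtP i k.
have nu0 p : (forall i, ~ first p i) -> nu p = x.
  by move=> np; rewrite /nu; case: xgetP => // y _ [i /np].
have firstS p q m i : i < m -> mkseq (q : baire) m = mkseq (p : baire) m ->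
    first p i -> first q i.
  move=> im /eq_in_mkseq qp [pi pj]; split=> [|j ji]; rewrite qp// ?pj//.
  exact: ltn_trans im.
have cnu : continuous nu.
  move=> p; have [[i pi]|/forallNP np] := pselect (exists i, first p i).
    apply: (near_cst_continuous (u i)).
    apply: filterS (near_mkseq_id p i.+1) => q qp.
    by apply: nuE; exact: (firstS _ _ _ _ (ltnSn i) qp pi).
  (* Here [p] has no first nonzero entry, so a [q] agreeing with it on [N] places can have one only
     at [N] or later, where [u] already stays in [A]. *)
  rewrite /continuous_at (nu0 _ np) => A Ax; have [N _ NA] := ux A Ax.
  apply: filterS (near_mkseq_id p N) => q qp /=.
  have [[i qi]|/forallNP nq] := pselect (exists i, first q i); last first.
    by rewrite nu0//; exact: nbhs_singleton.
  rewrite (nuE _ _ qi); apply: NA => /=; rewrite leqNgt; apply/negP => iN.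
  by apply: (np i); exact: (firstS _ _ _ _ iN (esym qp) qi).
have [g cg gE] := l _ baire_coded _ cnu.
pose e n : baire := fun i => nat_of_bool (i == n).
exists (fun n => g (e n)), (g (fun=> 0)); split.
- apply: (@continuous_cvg _ _ _ _ _ e g (fun=> 0)); first exact: cg.
  move=> A /baire_nbhs[m mA]; exists m => // n /= mn; apply/mA/eq_in_mkseq => i im.
  by rewrite /e; case: eqP => // ?; move: (leq_trans im mn); subst; rewrite ltnn.
- move=> n; rewrite -gE; apply: nuE; split=> [|j jn]; rewrite /e ?eqxx//.
  by rewrite (ltn_eqF jn).
- by rewrite -gE; apply: nu0 => i [].
Qed.

Lemma lifting_quotient {X : topologicalType} {D : set baire} (delta : D -> X) :
  (forall A : set X, seq_open A -> open A) ->
  continuous delta -> lifting delta -> quotient_map delta.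
Proof.
move=> sX cd ld; have [rd _ _] : admissible delta by apply/admissibleP.
split=> // U; split=> [|oU]; first by move/continuousP: cd; apply.
apply: sX => u x Ux /(lifting_cvg _ ld)[a [a0 [aa0 au a0x]]].
have : nbhs a0 (delta @^-1` U).
  by apply: open_nbhs_nbhs; split => //; rewrite /preimage/= a0x.
by move=> /aa0[N _ NU]; exists N => // n /NU /=; rewrite au.
Qed.

(** * Partial continuous functions coded by points of the Baire space *)

(* A name [p] acts on [a] by answering queries about finite prefixes of [a]:
   an answer [0] asks for a longer prefix, an answer [v.+1] outputs [v]. *)
Definition answer (p a : baire) (n m : nat) : nat := p (pickle (n, mkseq a m)).

(** Only the first nonzero answer counts; this makes the output unique for arbitrary [p] and [a]. *)
Definition computes (p a c : baire) := forall n, exists m,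
  answer p a n m = (c n).+1 /\ forall j, j < m -> answer p a n j = 0.

Lemma computes_first {p a c : baire} {n m v} : computes p a c ->
  answer p a n m = v.+1 -> (forall j, j < m -> answer p a n j = 0) -> c n = v.
Proof.
move=> /(_ n)[k [pk k0]] pm m0.
have [km|mk|e] := ltngtP k m; first by rewrite (m0 k) in pk.
  by rewrite (k0 m) in pm.
by move: pk; rewrite e pm => -[].
Qed.

Lemma computes_inj {p a c d : baire} : computes p a c -> computes p a d -> c = d.
Proof.
move=> pc pd; apply/funext => n; have [m [pm m0]] := pd n.
exact: (computes_first pc pm m0).
Qed.

(** An undefined computation stalls at a single output position, so undefinedness is a countable
    union of closed conditions. *)
Lemma not_computes (p a : baire) : (~ exists c, computes p a c) <->
  exists n, forall m, answer p a n m = 0.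
Proof.
split=> [nc|[n n0] [c /(_ n)[m]]]; last by rewrite n0 => -[].
apply: contrapT => /forallNP h; apply: nc.
suff /choice[c pc] : forall n, exists v m,
    answer p a n m = v.+1 /\ forall j, j < m -> answer p a n j = 0 by exists c.
move=> n; have ex : exists m, answer p a n m != 0.
  apply: contrapT => /forallNP hn; apply: (h n) => m.
  by apply/eqP/negPn/negP/hn.
have [m pm mmin] := ex_minnP ex; exists (answer p a n m).-1, m.
split=> [|j jm]; first by rewrite prednK// lt0n.
apply/eqP; rewrite -[_ == _]negbK; apply/negP => /mmin.
by rewrite leqNgt jm.
Qed.

Section answer_continuous.
Context {Z : topologicalType} {p a c : Z -> baire}.
Hypotheses (cp : continuous p) (ca : continuous a) (cc : continuous c).

Lemma near_mkseq z m : \forall z' \near z, mkseq (a z') m = mkseq (a z) m.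
Proof. by have := ca z _ (near_mkseq_id (a z) m). Qed.

Lemma answer_near z n m :
  \forall z' \near z, answer (p z') (a z') n m = answer (p z) (a z) n m.
Proof.
have H : \forall z' \near z, p z' (pickle (n, mkseq (a z) m)) = answer (p z) (a z) n m.
  have := comp_continuous cp (coord_continuous (pickle (n, mkseq (a z) m))) z
    [set answer (p z) (a z) n m].
  by apply; exact/nbhs_nat.
by apply: filterS2 (near_mkseq z m) H => z'; rewrite /answer => ->.
Qed.

Lemma answer_zero_near z n m :
  \forall z' \near z, (forall j, j < m -> answer (p z') (a z') n j = 0) <->
    (forall j, j < m -> answer (p z) (a z) n j = 0).
Proof.
have : \forall z' \near z, forall j, j < m ->
    answer (p z') (a z') n j = answer (p z) (a z) n j.
  elim: m => [|m IH]; first exact: (@filterS _ _ _ setT _ _ filterT).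
  apply: filterS2 IH (answer_near z n m) => z' IH H j.
  by rewrite ltnS leq_eqVlt => /orP[/eqP -> //|]; exact: IH.
by apply: filterS => z' h; split=> h0 j jm; rewrite -?h ?h0// h// h0.
Qed.

(** Each output entry depends on finitely many entries of [p] and [a], hence imposes an open
    condition. *)
Lemma Pi02_computes : Pi02 Z [set z | computes (p z) (a z) (c z)].
Proof.
pose O n := [set z | exists m, answer (p z) (a z) n m = (c z n).+1 /\
  forall j, j < m -> answer (p z) (a z) n j = 0].
have -> : [set z | computes (p z) (a z) (c z)] = \bigcap_n O n.
  by apply/seteqP; split=> z h n; [move=> _|]; exact: h.
apply: Pi02_bigcap => n; rewrite openE => z [m [pm m0]].
have H : \forall z' \near z, c z' n = c z n.
  by have := comp_continuous cc (coord_continuous n) z [set c z n]; apply; exact/nbhs_nat.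
apply: filterS3 H (answer_near z n m) (answer_zero_near z n m) => z' cz' az' z0'.
by exists m; rewrite az' cz'; split => //; exact/z0'.
Qed.

Lemma Sigma02_not_computes : Sigma02 Z [set z | ~ exists d, computes (p z) (a z) d].
Proof.
have -> : [set z | ~ exists d, computes (p z) (a z) d] =
    \bigcup_n [set z | forall m, answer (p z) (a z) n m = 0].
  by apply/seteqP; split=> z /=; [move=> /not_computes[n]; exists n|
     move=> [n _ ?]; apply/not_computes; exists n].
apply: Sigma02_bigcup => n.
rewrite -[X in closed X]setCK; apply: open_closedC; rewrite openE => z /= /existsNP[m pm].
by apply: filterS (answer_near z n m) => z' az' /(_ m); rewrite az'.
Qed.

End answer_continuous.

Lemma computed_continuous {Z : topologicalType} (p a c : Z -> baire) :
  continuous p -> continuous a ->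
  (forall z, computes (p z) (a z) (c z)) -> continuous c.
Proof.
move=> cp ca pc; apply: continuous_baire => n z; have [m [pm m0]] := pc z n.
apply: (near_cst_continuous (c z n)).
apply: filterS2 (answer_near cp ca z n m) (answer_zero_near cp ca z n m) => z' az' z0'.
apply: (@computes_first _ _ _ n m _ (pc z')); [by rewrite az' pm|exact/z0'].
Qed.

(** * Convergence in the exponential *)

Lemma nbhs_sequentialization {T : topologicalType} (A : set T) (x : T) :
  nbhs (x : sequentialization T) A <-> exists B, [/\ seq_open B, B x & B `<=` A].
Proof. by []. Qed.

(** Open sets are sequentially open, and a sequentially open set absorbs, by definition, the
    sequences converging in the original topology to one of its points. *)
Lemma cvg_sequentialization {T : topologicalType} (u : nat -> T) (x : T) :
  u n @[n --> \oo] --> x <->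
  (u n : sequentialization T) @[n --> \oo] --> (x : sequentialization T).
Proof.
split=> ux A.
  move=> /nbhs_sequentialization[B [sB Bx BA]].
  by have [N _ NB] := sB u x Bx ux; exists N => // n /NB /BA.
rewrite nbhsE => -[B [oB Bx] BA]; have : nbhs (x : sequentialization T) A.
  apply/nbhs_sequentialization; exists B; split => // v y By; apply.
  exact: open_nbhs_nbhs.
exact: ux.
Qed.

Lemma sequentialization_sequential {T : topologicalType}
  (A : set (sequentialization T)) : seq_open A -> open A.
Proof.
move=> sA; suff h : @seq_open T A by exact: h.
by move=> u x Ax /cvg_sequentialization; exact: sA.
Qed.

Lemma exponential_cvg {X Y : topologicalType} (u : nat -> continuousType X Y)
    (f : continuousType X Y) :
  (u n : exponential X Y) @[n --> \oo] --> (f : exponential X Y) <->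
  forall K V, compact K -> open V -> f @` K `<=` V ->
    \forall n \near \oo, u n @` K `<=` V.
Proof.
rewrite -cvg_sequentialization; split.
  move=> uf K V cK oV fKV.
  have := uf [set g : continuousType X Y | g @` K `<=` V]; apply.
  apply: open_nbhs_nbhs; split => //.
  by exists ([set g : X -> Y | g @` K `<=` V]) => //; exact: compact_open_open.
move=> h A [_ [[B oB <-] Bf] BA].
have /= : (fun n => (u n : {compact-open, X -> Y})) @ \oo --> (f : {compact-open, X -> Y}).
  by apply/compact_open_cvgP.
move=> /(_ B (open_nbhs_nbhs (conj oB Bf)))[N _ NB].
by exists N => // n /NB; exact: BA.
Qed.

(** In the near-covering form of compactness, a neighbourhood of the limit handles the terms from
    some [N] on; the earlier ones are added by induction. *)
Lemma compact_cvg {X : topologicalType} (u : nat -> X) x :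
  u n @[n --> \oo] --> x -> compact (x |` range u).
Proof.
move=> ux; apply/compact_near_coveringP => I F P FF h.
have [[/= U V] [Ux FV] UVP] := h x (or_introl erefl).
have [N _ NU] := ux U Ux.
have H M : \forall i \near F, forall n, n < M -> P i (u n).
  elim: M => [|M IH]; first exact: (@filterS _ _ _ setT _ _ filterT).
  have [[/= U' V'] [Ux' FV'] UVP'] := h (u M) (or_intror (ex_intro2 _ _ M Logic.I erefl)).
  apply: filterS2 IH FV' => i IH Vi n; rewrite ltnS leq_eqVlt => /orP[/eqP ->|].
    by apply: (UVP' (u M, i)); split => //=; exact: nbhs_singleton.
  exact: IH.
apply: filterS2 FV (H N) => i Vi Hi _ [->|[n _ <-]].
  by apply: (UVP (x, i)); split => //=; exact: nbhs_singleton.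
have [/Hi //|Nn] := ltnP n N.
by apply: (UVP (u n, i)); split => //=; exact: NU.
Qed.

Lemma continuous_subset {Z : topologicalType} {D : set baire} (f : Z -> D) :
  continuous (fun z => val (f z) : baire) -> continuous f.
Proof. exact: (@continuous_comp_initial D Z baire val f). Qed.

(** Distinct maps differ at some [x]; an open set separating the values is pulled back along
    evaluation at [x], which is sequentially continuous because [[set x]] is compact. *)
Lemma exponential_kolmogorov {X Y : topologicalType} :
  kolmogorov_space Y -> kolmogorov_space (exponential X Y).
Proof.
move=> kY f g fg.
have [x fgx] : exists x, (f : continuousType X Y) x <> (g : continuousType X Y) x.
  apply: contrapT => /forallNP h; move/eqP: fg; apply; apply/continuousEP => x.
  exact: contrapT.
have H (f' : continuousType X Y) A : nbhs (f' x) A ->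
    nbhs (f' : exponential X Y) [set h : exponential X Y | A ((h : continuousType X Y) x)].
  rewrite (@nbhsE Y (f' x)) => -[B [oB Bf] BA].
  apply: (@filterS _ _ _ [set h : exponential X Y | B ((h : continuousType X Y) x)]).
    by move=> h; exact: BA.
  apply/nbhs_sequentialization.
  exists [set h : exponential X Y | B ((h : continuousType X Y) x)]; split => //.
  move=> u h Bh uh.
  have uh' := (exponential_cvg u h).1 ((cvg_sequentialization u h).1 uh).
  have [|N _ NB] := uh' [set x] B (@compact_set1 _ x) oB; first by move=> _ [_ -> <-].
  by exists N => // n /NB; apply; exists x.
move/eqP: fgx => /kY[A []].
  rewrite !inE => -[nA Ag]; exists [set h : exponential X Y | A ((h : continuousType X Y) x)].
  by left; rewrite !inE; split => //; exact: H.
rewrite !inE => -[nA Ag]; exists [set h : exponential X Y | A ((h : continuousType X Y) x)].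
by right; rewrite !inE; split => //; exact: H.
Qed.

(** * Names of continuous functions *)

Section function_names.
Context {X Y : topologicalType} {D E : set baire}.
Variables (delta : D -> X) (gamma : E -> Y).
Hypotheses (dq : quotient_map delta) (cg : continuous gamma).

Definition tracks (p : baire) (f : X -> Y) := forall a : D,
  exists c : E, computes p (val a) (val c) /\ gamma c = f (delta a).

Definition names : set baire :=
  [set p | exists f : continuousType X Y, tracks p f].

Lemma name_ex (p : names) : exists f : continuousType X Y, tracks (val p) f.
Proof. exact: (set_mem (valP p)). Qed.

(** The choice is harmless: by [tracks_inj] a name tracks only one continuous map. *)
Definition named (p : names) : exponential X Y := sval (cid (name_ex p)).

Lemma named_tracks (p : names) : tracks (val p) (named p : continuousType X Y).
Proof. exact: svalP (cid (name_ex p)). Qed.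

Lemma tracks_inj {p} {f g : continuousType X Y} : tracks p f -> tracks p g -> f = g.
Proof.
move=> pf pg; apply/continuousEP => x; have [a <-] := dq.1 x.
have [[c [pc <-]] [d [pd <-]]] := (pf a, pg a).
by congr gamma; apply/val_inj/(computes_inj pc pd).
Qed.

(** [F] is continuous because it is computed from its argument, and being extensional it descends
    along the quotient map [delta]. *)
Lemma realizer_tracks {p} (F : D -> E) :
  (forall a, computes p (val a) (val (F a))) ->
  (forall a b, delta a = delta b -> gamma (F a) = gamma (F b)) ->
  exists f : continuousType X Y, forall a, f (delta a) = gamma (F a).
Proof.
move=> pF Fext; have cF : continuous F.
  apply: continuous_subset.
  apply: (@computed_continuous D (fun=> p) (fun a => val a) (fun a => val (F a))) => //.
    exact: cst_continuous.
  exact: val_continuous.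
have [s sK] := choice dq.1.
have fE a : gamma (F (s (delta a))) = gamma (F a) by apply: Fext.
have cf : continuous (fun x => gamma (F (s x))).
  apply/continuousP => V oV; apply/dq.2.
  have -> : delta @^-1` ((fun x => gamma (F (s x))) @^-1` V) = (fun a => gamma (F a)) @^-1` V.
    by apply/seteqP; split=> a /=; rewrite fE.
  by have /continuousP := comp_continuous cF cg; apply.
by exists (mkcts cf) => a; exact: fE.
Qed.

(** Since [a] and [b] range over all pairs of names of a common point, the right-hand side also
    encodes that [p] and [q] are total and extensional, hence lie in [names]. *)
Lemma EQ_named (p q : baire) : EQ named (p, q) <->
  forall a b, EQ delta (a, b) ->
    exists c d, [/\ computes p a c, computes q b d & EQ gamma (c, d)].
Proof.
split=> [[p' [q' [[-> ->] pq]]] _ _ [a [b [[-> ->] ab]]]|h].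
  have [c [pc ce]] := named_tracks p' a; have [d [qd de]] := named_tracks q' b.
  exists (val c), (val d); split => //; exists c, d; split => //.
  by rewrite ce de pq ab.
have h' (a b : D) : delta a = delta b -> exists c d : E,
    [/\ computes p (val a) (val c), computes q (val b) (val d) & gamma c = gamma d].
  move=> ab; have [|c0 [d0 [pc qd [c [d [e cd]]]]]] := h (val a) (val b).
    by exists a, b.
  by case: e pc qd => -> -> pc qd; exists c, d.
have /choice[F pF] : forall a : D, exists c : E, computes p (val a) (val c).
  by move=> a; have [c [_ [? _ _]]] := h' a a erefl; exists c.
have Fext a b (d : E) : delta a = delta b -> computes q (val b) (val d) ->
    gamma (F a) = gamma d.
  move=> /h'[c [d' [pc qd' cd]]] qd.
  have -> : F a = c by apply/val_inj/(computes_inj (pF a) pc).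
  by rewrite cd; congr gamma; apply/val_inj/(computes_inj qd' qd).
have [|f fE] := realizer_tracks F pF.
  (* The outputs of [p] on [a] and on [b] are both compared with the output of [q] on [b]. *)
  move=> a b ab; have [_ [d [_ qd _]]] := h' b b erefl.
  by rewrite (Fext _ _ _ ab qd) (Fext _ _ _ erefl qd).
have pf : tracks p f by move=> a; exists (F a); rewrite fE.
have qf : tracks q f.
  move=> a; have [_ [d [_ qd _]]] := h' a a erefl.
  by exists d; rewrite fE; split => //; rewrite (Fext _ _ _ erefl qd).
have np : p \in names by apply/mem_set; exists f.
have nq : q \in names by apply/mem_set; exists f.
exists (exist _ p np), (exist _ q nq); split => //.
rewrite (tracks_inj (named_tracks (exist _ p np)) pf).
by rewrite (tracks_inj (named_tracks (exist _ q nq)) qf).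
Qed.

Lemma EQ_namedC (G : pointclass) :
  closed_preimage G -> closed_setI G -> closed_setU G ->
  (forall Z, Pi02 Z `|` Sigma02 Z `<=` G Z) ->
  G _ (EQ delta) -> G _ (~` EQ gamma) ->
  proj_class G _ (~` EQ named).
Proof.
move=> Gf GI GU G0 Gd Gg.
pose Z : topologicalType := (baire * (baire * baire))%type.
have cpart i : continuous (fun z : Z => part i z.1).
  exact: comp_continuous fst_continuous (part_continuous i).
have cp : continuous (fun z : Z => z.2.1).
  exact: comp_continuous snd_continuous fst_continuous.
have cq : continuous (fun z : Z => z.2.2).
  exact: comp_continuous snd_continuous snd_continuous.
(* The computed values [part 2] and [part 3] are quantified along with the
   arguments [part 0] and [part 1]: then [EQ gamma] only enters complemented,
   and never under a universal quantifier. *)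
exists ([set z : Z | EQ delta (part 0 z.1, part 1 z.1)] `&`
  ([set z : Z | ~ exists c, computes z.2.1 (part 0 z.1) c] `|`
  ([set z : Z | ~ exists d, computes z.2.2 (part 1 z.1) d] `|`
  (([set z : Z | computes z.2.1 (part 0 z.1) (part 2 z.1)] `&`
   [set z : Z | computes z.2.2 (part 1 z.1) (part 3 z.1)]) `&`
   [set z : Z | (~` EQ gamma) (part 2 z.1, part 3 z.1)])))).
  apply: (GI).
    apply: (Gf _ _ (fun z : Z => (part 0 z.1, part 1 z.1)) (EQ delta)) => //.
    exact: pair_continuous.
  apply: (GU); first by apply: (G0); right; exact: Sigma02_not_computes.
  apply: (GU); first by apply: (G0); right; exact: Sigma02_not_computes.
  apply: (GI); last first.
    apply: (Gf _ _ (fun z : Z => (part 2 z.1, part 3 z.1)) (~` EQ gamma)) => //.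
    exact: pair_continuous.
  by apply: (GI); apply: (G0); left; exact: Pi02_computes.
apply/seteqP; split=> -[p q].
  move=> [r [/= ab h]] /EQ_named/(_ _ _ ab)[c [d [pc qd cd]]].
  case: h => [|[|[[pc' qd'] ncd]]]; [by apply; exists c|by apply; exists d|].
  by apply: ncd; rewrite (computes_inj pc' pc) (computes_inj qd' qd).
move=> npq; apply: contrapT => nr; apply: npq; apply/EQ_named => a b ab.
apply: contrapT => ncd; apply: nr.
(* If [p] or [q] is undefined on its argument, parts 2 and 3 of the witness are fillers; otherwise
   they are the computed values. *)
have [[c pc]|nc] := pselect (exists c, computes p a c); last first.
  exists (join (fun i => if i == 0 then a else b)) => /=.
  by rewrite !part_join; split => //; left.
have [[d qd]|nd] := pselect (exists d, computes q b d); last first.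
  exists (join (fun i => if i == 0 then a else b)) => /=.
  by rewrite !part_join; split => //; right; left.
exists (join (fun i => nth a [:: a; b; c; d] i)) => /=.
rewrite !part_join /=; split => //; right; right; split => //.
by move=> cd; apply: ncd; exists c, d.
Qed.

(** For [k = 0] the data are $\mathbf{\Delta}^1_1$, so [EQ_namedC] applies with
    $\mathbf{\Sigma}^1_1$, which absorbs the projection. For [k = n.+1] it applies with
    $\mathbf{\Pi}^1_{n+1}$, and the projection leads to $\mathbf{\Sigma}^1_{n+2}$. *)
Lemma Pi1_EQ_named k : Pi1 k _ (EQ delta) -> Sigma1 k _ (EQ gamma) ->
  Pi1 k.+1 _ (EQ named).
Proof.
move=> dk gk; apply/coE; case: k dk gk => [[d0 _] [_ /coE g0]|n dn gn].
  have [I0 U0] := projective_setIU 0.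
  have [A GA <-] : proj_class (projective 0) _ (~` EQ named).
    apply: EQ_namedC => //; first exact: projective_preimage.
    by move=> Z A /(projective_Pi02_Sigma02 0)[].
  exact: projective_pr.
have [nI nU] := projective_setIU n; apply: EQ_namedC => //.
- exact/co_preimage/projective_preimage.
- exact: co_setI.
- exact: co_setU.
- by move=> Z A /(projective_Pi02_Sigma02 n)[].
- by apply/coE; rewrite setCK.
Qed.

Lemma named_eval_continuous : continuous (fun z : names * D =>
  (named z.1 : continuousType X Y) (delta z.2)).
Proof.
have /choice[F FE] : forall z : names * D, exists c : E,
    computes (val z.1) (val z.2) (val c) /\
    gamma c = (named z.1 : continuousType X Y) (delta z.2).
  by move=> z; exact: named_tracks.
have -> : (fun z : names * D => (named z.1 : continuousType X Y) (delta z.2)) =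
    (fun z => gamma (F z)).
  by apply/funext => z; have [_] := FE z.
apply: comp_continuous cg; apply: continuous_subset.
apply: (@computed_continuous (names * D)%type (fun z => val z.1)
  (fun z => val z.2) (fun z => val (F z))).
- exact: comp_continuous fst_continuous (val_continuous _).
- exact: comp_continuous snd_continuous (val_continuous _).
- by move=> z; have [] := FE z.
Qed.

Lemma named_continuous : continuous named.
Proof.
apply: seq_continuous; first by have /codedP[] := subset_coded names.
move=> u p up; apply/exponential_cvg => K V cK oV pKV.
pose G := [set z : names * D | V ((named z.1 : continuousType X Y) (delta z.2))].
have oG : open G by have /continuousP := named_eval_continuous; apply.
have Gu q a : G (q, a) -> exists P Q, [/\ nbhs q P, nbhs a Q &
    forall q' a', P q' -> Q a' -> G (q', a')].
  move: oG; rewrite openE => /[apply] -[[P Q] /= [qP aQ] PQG].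
  by exists P, Q; split => // q' a' ? ?; exact: PQG.
pose S N := [set x | V ((named p : continuousType X Y) x) /\
  forall n, N <= n -> V ((named (u n) : continuousType X Y) x)].
(* [delta] is a quotient map and [\oo] with the [n >= N] is compact, so the
   tube lemma makes the preimage of [S N] open. *)
have oS N : open (S N).
  apply/dq.2; rewrite openE => a [pa ua].
  have [P [Q [Pp Qa PQG]]] := Gu p a pa; have [M _ MP] := up P Pp.
  (* The neighbourhood [P] of [p] takes care of the indices from [M] on; each of the finitely many
     below [M] requires shrinking around [a] once more. *)
  have H : \forall a' \near a, forall n, n < M -> N <= n -> G (u n, a').
    elim: (M) => [|m IH]; first exact: (@filterS _ _ _ setT _ _ filterT).
    have H : \forall a' \near a, N <= m -> G (u m, a').
      have [Nm|mN] := leqP N m; last exact: (@filterS _ _ _ setT _ _ filterT).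
      have [P' [Q' [Pp' Qa' PQG']]] := Gu (u m) a (ua m Nm).
      by apply: filterS Qa' => a' Qa' _; apply: PQG' => //; exact: nbhs_singleton.
    apply: filterS2 IH H => a' IH H n; rewrite ltnS leq_eqVlt => /orP[/eqP -> //|].
    exact: IH.
  apply: filterS2 Qa H => a' Qa' H; split; first by apply: (PQG p) => //; exact: nbhs_singleton.
  move=> n Nn; have [nM|Mn] := ltnP n M; first exact: H.
  by apply: (PQG (u n)) => //; exact: MP.
(* Compactness is applied with [n] tending to infinity as the parameter: near each point of [K] a
   single [S M] serves all [n >= M]. *)
move/compact_near_coveringP: cK => /(_ nat \oo
  (fun n x => V ((named (u n) : continuousType X Y) x)) _) cK.
have : \forall n \near \oo, K `<=` (fun x => V ((named (u n) : continuousType X Y) x)).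
  apply: cK => x Kx; have [a ax] := dq.1 x.
  have pa : G (p, a) by rewrite /G /= ax; apply: pKV; exists x.
  have [P [Q [Pp Qa PQG]]] := Gu p a pa; have [M _ MP] := up P Pp.
  exists (S M, [set n | M <= n]) => /=; last by move=> [y n] [/= [_ h] /h].
  split; last by exists M.
  apply: open_nbhs_nbhs; split => //; rewrite /S /= -ax; split => // n Mn.
  by apply: (PQG (u n) a); [exact: MP|exact: nbhs_singleton].
by apply: filterS => n Kn _ [x Kx <-]; exact: Kn.
Qed.

End function_names.

(** * Currying *)

Section lifting_named.
Context {X Y : topologicalType} {D E : set baire}.
Variables (delta : D -> X) (gamma : E -> Y).
Hypotheses (dq : quotient_map delta) (lg : lifting gamma).

(** Along a convergent sequence of pairs, the points [delta (u n).2] and their limit form a compact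
    set, on which convergence in the exponential is uniform enough to control the values. *)
Lemma uncurry_continuous {W : topologicalType} (nu : W -> exponential X Y) :
  coded W -> continuous nu -> continuous (fun z : W * D =>
    (nu z.1 : continuousType X Y) (delta z.2)).
Proof.
move=> cW cnu; have cd : continuous delta by apply/continuousP => V /dq.2.
apply: seq_continuous.
  by have /codedP[] := prod_coded _ _ cW (subset_coded D).
move=> u [w a] uwa A; rewrite nbhsE => -[V [oV Vx] VA].
have uw : (u n).1 @[n --> \oo] --> w.
  by apply: (@continuous_cvg _ _ _ _ _ u fst (w, a)) => //; exact: fst_continuous.
have ua : delta (u n).2 @[n --> \oo] --> delta a.
  apply: (@continuous_cvg _ _ _ _ _ u (fun z : W * D => delta z.2) (w, a)) => //.
  exact: (comp_continuous snd_continuous cd).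
have [N _ NV] : \forall n \near \oo,
    V ((nu w : continuousType X Y) (delta (u n).2)).
  have := ua ((nu w : continuousType X Y) @^-1` V); apply.
  have /= := @cts_fun _ _ (nu w : continuousType X Y) (delta a) V; apply.
  exact: open_nbhs_nbhs.
(* The first [N] terms are dropped because [nu w] must map the whole compact set into [V]. *)
have shift : delta (u (n + N)).2 @[n --> \oo] --> delta a.
  move=> B /ua[M _ MB]; exists M => // n Mn; apply: MB => /=.
  exact: leq_trans Mn (leq_addr _ _).
have /exponential_cvg/(_ _ V (compact_cvg _ _ shift) oV) :
    nu (u n).1 @[n --> \oo] --> nu w.
  by apply: (continuous_cvg _ _ uw); exact: cnu.
move=> [|M _ MV]; first by move=> _ [_ [->|[n _ <-]] <-] //; apply: NV; exact: leq_addl.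
exists (maxn M N) => // n /=; rewrite geq_max => /andP[Mn Nn]; apply: VA.
apply: (MV n Mn); exists (delta (u n).2) => //.
by right; exists (n - N) => //; rewrite subnK.
Qed.

(* The answer of the name of [g w] to a prefix [s] is the value forced by [s]
   together with the equally long prefix of the code of [w]; it depends on a
   finite part of that code only, hence continuously on [w]. *)
Lemma curry_names {W : topologicalType} (e : W -> baire) (F : W * D -> E) :
  coding e -> continuous F ->
  exists2 g : W -> baire, continuous g &
    forall w a, computes (g w) (val a) (val (F (w, a))).
Proof.
move=> ce cF.
pose forced w n s := [set v | forall w' (a : D), mkseq (e w') (size s) = mkseq (e w) (size s) ->
  mkseq (val a) (size s) = s -> (val (F (w', a)) : baire) n = v].
(* When no value is forced, the default [0] asks for a longer prefix. Several values can be forced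
   only if no point of [D] extends [s]. *)
pose out w n s := xget 0 [set k | exists2 v, forced w n s v & k = v.+1].
pose g w : baire := fun k => if unpickle k is Some (n, s) then out w n s else 0.
have gE w (a : baire) n m : answer (g w) a n m = out w n (mkseq a m).
  by rewrite /answer /g pickleK.
have outP w (a : D) n m v : out w n (mkseq (val a) m) = v.+1 ->
    (val (F (w, a)) : baire) n = v.
  rewrite /out; case: xgetP => // _ _ [v' fv' ->] [<-].
  by apply: fv'; rewrite size_mkseq.
exists g.
  apply: continuous_baire => k w; rewrite /g.
  case: (unpickle k) => [[n s]|]; last exact: cst_continuous.
  apply: (near_cst_continuous (out w n s)).
  apply: filterS (coding_near ce w (size s)) => w' ww'.
  by rewrite /out /forced ww'.
(* Some answer arrives at every position, since continuity of [F] at [(w, a)] forces the value from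
   a long enough prefix; by [outP] any answer is correct. *)
move=> w a; have [c gc] : exists c, computes (g w) (val a) c.
  apply: contrapT => /not_computes[n n0].
  have cFn : continuous (fun z => (val (F z) : baire) n).
    exact: (comp_continuous (comp_continuous cF (val_continuous E)) (coord_continuous n)).
  have [[P Q] /= [/ce[i iP] /(@subset_coding D)[j jQ]] PQ] :=
    cFn (w, a) _ ((nbhs_nat _ [set (val (F (w, a)) : baire) n]).2 erefl).
  have := n0 (maxn i j); rewrite gE /out.
  case: xgetP => [_ _ [v _ ->] //|/(_ ((val (F (w, a)) : baire) n).+1) h _]; apply: h.
  exists ((val (F (w, a)) : baire) n) => // w' a'; rewrite size_mkseq => ww' aa'.
  apply: (PQ (w', a')); split=> /=.
    by apply: iP; apply: eq_mkseq_le ww'; rewrite leq_maxl.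
  by apply: jQ; apply: eq_mkseq_le aa'; rewrite leq_maxr.
suff -> : val (F (w, a)) = c by [].
by apply/funext => n; have [m [+ _]] := gc n; rewrite gE; exact: outP.
Qed.

Lemma named_lifting : lifting (named delta gamma).
Proof.
move=> W cW nu cnu.
have [F cF FE] := lg _ (prod_coded _ _ cW (subset_coded D)) _ (uncurry_continuous nu cW cnu).
have [e [ce _]] := cW.
have [g cg gE] := curry_names e F ce cF.
have gt w : tracks delta gamma (g w) (nu w : continuousType X Y).
  by move=> a; exists (F (w, a)); rewrite -FE.
have gn w : g w \in names delta gamma by apply/mem_set; exists (nu w).
exists (fun w => exist _ (g w) (gn w)); first exact: continuous_subset.
move=> w; apply: (tracks_inj delta gamma dq (gt w)).
exact: (named_tracks delta gamma (exist _ (g w) (gn w))).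
Qed.

End lifting_named.

Theorem theorem7p1 (k : nat) (X Y : topologicalType)
  (hX : QCB0 (Pi1 k) X) (hY : QCB0 (Sigma1 k) Y) :
  QCB0 (Pi1 k.+1) (exponential X Y).
Proof.
have [qX [D [delta [/admissibleP[cd ld] dk]]]] := hX.
have [[kY _] [E [gamma [/admissibleP[cg lg] gk]]]] := hY.
have dq : quotient_map delta by exact: lifting_quotient (qcb0_sequential qX) cd ld.
have cn := named_continuous delta gamma dq cg.
have ln := named_lifting delta gamma dq lg.
split; last first.
  exists (names delta gamma), (named delta gamma); split; first exact/admissibleP.
  exact: Pi1_EQ_named.
split; first exact: exponential_kolmogorov.
exists (names delta gamma : topologicalType).
  by have /codedP[] := subset_coded (names delta gamma).
(* The exponential is sequential by construction, so the lifting property makes [named] a quotient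
   map. *)
exists (named delta gamma); apply: lifting_quotient => // A.
exact: sequentialization_sequential.
Qed.
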